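(* Consider the power network in which the inverters at the buses $i\in ID$ implement iDroop control (as described in the context), and let $(\theta^*(t),\omega^*,{q^r}^* )$ be its steady state solution. Then the steady state solution is given by $$\theta^*(t)=\theta^*+\mathbf 1_n\omega_0^*t,\qquad \omega_i^*=\omega_0^*\ \ \forall i\in N,\qquad {q_i^r}^*-q_i^{r,0}=x_i^*=-\frac{\omega_0^*}{R_i^r}\ \ \forall i\in ID,$$ where $\mathbf 1_n$ is the all-ones vector and $$\omega_0^*=\frac{\sum_{i=1}^n (p_i^{in}+q_i^{r,0})}{\sum_{i=1}^n (D_i+1/R_i^g)+\sum_{i\in ID}1/R_i^r}.$$ Moreover, if $R_i^g=\alpha_i^g$ for all $i\in N$ and $R_i^r=\alpha_i^r$ for all $i\in ID$, then $$\delta {q_i^g}^*:=-\frac1{R_i^g}\omega_0^*\ \ (i\in N),\qquad \delta {q_i^r}^*:={q_i^r}^*-q_i^{r,0}\ \ (i\in ID)$$ is the unique allocation that minimizes the steady state cost $$\sum_{i=1}^n\frac{\alpha_i^g}{2}(\delta q_i^g)^2+\sum_{i\in ID}\frac{\alpha_i^r}{2}(\delta q_i^r)^2$$ subject to the supply-demand balance $$\sum_{i=1}^n\delta q_i^g+\sum_{i\in ID}\delta q_i^r=\Delta P,\qquad\text{where }\Delta P=\sum_{i=1}^n\left(p_i^{in}+q_i^{r,0}-D_i\omega_0^*\right).$$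
   Context: The network is a connected graph $G=(N,E)$ with buses $N=\{1,\dots,n\}$ and line susceptances $b_{ij}=b_{ji}>0$; $L_B$ is the $b_{ij}$-weighted graph Laplacian ($(L_B)_{ij}=-b_{ij}$ for $ij\in E$, $i\ne j$; $(L_B)_{ii}=\sum_{k:\,ik\in E}b_{ik}$; $0$ otherwise). The dynamics are $$\dot\theta_i=\omega_i,\qquad M_i\dot\omega_i=p_i^{in}+q_i^r-\Big(D_i+\frac1{R_i^g}\Big)\omega_i-(L_B\theta)_i,\qquad i\in N.$$ $ID\subseteq N$ is the set of buses implementing iDroop: $$q_i^r=q_i^{r,0}+x_i,\qquad \dot x_i=\delta_i\Big(-\frac1{R_i^r}\omega_i-x_i\Big)-\nu_i\dot\omega_i,\qquad i\in ID,$$ with arbitrary controller parameter values $\delta_i,\nu_i\in\mathbb R$; at buses $i\notin ID$ the inverter injects constant power $q_i^r=q_i^{r,0}$. Here $p_i^{in}$ (net constant power injection) and $q_i^{r,0}$ (inverter power set point) are real constants, and $M_i$ (inertia), $D_i$ (damping and frequency-dependent load coefficient), $R_i^g$, $R_i^r$ (generator and inverter droop coefficients), $\alpha_i^g$, $\alpha_i^r$ (cost coefficients) are positive constants. The variables $\delta q_i^g$ and $\delta q_i^r$ are real numbers representing power deviations of generators and inverters; the prefix $\delta$ there denotes deviation and is unrelated to the parameters $\delta_i$. A steady state solution is a solution with $\theta^*(t)=\theta^*+\omega^*t$, where $\omega^*$, $x^*$ and ${q^r}^*$ are constant in time (so $\dot\omega=0$, $\dot x=0$).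
   Formalization: The supply-demand balance is taken with right side −ΔP, since the printed sign fails for the claimed optimum when ΔP ≠ 0; that every steady state has the given form is claimed only for δ_i ≠ 0 on ID, since with δ_i = 0 the value x_i* is arbitrary. *)

(* Defs.v *)
From HB Require Import structures.
From mathcomp Require Import all_boot all_order all_algebra.
From mathcomp Require Import all_classical all_reals all_analysis.
Import Order.TTheory GRing.Theory Num.Theory.
Import numFieldNormedType.Exports.

Set Implicit Arguments.
Unset Strict Implicit.
Unset Printing Implicit Defensive.

Local Open Scope ring_scope.

(* Buses are 'I_n.  [b i j] is meaningful only when [edge i j], and [Rr],
   [delta], [nu] only at the buses of [ID]. *)
Record network (R : realType) (n : nat) := Network {
  edge : rel 'I_n;
  b : 'I_n -> 'I_n -> R;
  M : 'I_n -> R;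
  D : 'I_n -> R;
  Rg : 'I_n -> R;
  pin : 'I_n -> R;
  q0 : 'I_n -> R;
  ID : {set 'I_n};
  Rr : 'I_n -> R;
  delta : 'I_n -> R;
  nu : 'I_n -> R
}.

Section Network.
Variables (R : realType) (n : nat) (G : network R n).

Definition well_formed : Prop :=
  [/\ (0 < n)%N,
      symmetric (edge G), irreflexive (edge G) &
      forall i j, connect (edge G) i j] /\
  [/\ forall i j, edge G i j -> b G i j = b G j i,
      forall i j, edge G i j -> 0 < b G i j,
      forall i, [/\ 0 < M G i, 0 < D G i & 0 < Rg G i] &
      forall i, i \in ID G -> 0 < Rr G i].

Definition laplacian : 'M[R]_n :=
  \matrix_(i, j) if i == j then \sum_(k | edge G i k) b G i k
                 else if edge G i j then - b G i j else 0.

(* [x t] and [qr t] are column vectors over all buses; the entries of [x t]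
   outside [ID] are unconstrained and play no role. *)
Definition is_solution (theta omega x qr : R -> 'cV[R]_n) : Prop :=
  forall (t : R) (i : 'I_n),
  [/\ is_derive t 1 (fun s => theta s i 0) (omega t i 0),
      derivable (fun s => omega s i 0) t 1,
      M G i * (fun s => omega s i 0)^`()%classic t =
        pin G i + qr t i 0 - (D G i + (Rg G i)^-1) * omega t i 0
        - (laplacian *m theta t) i 0,
      i \in ID G ->
        [/\ qr t i 0 = q0 G i + x t i 0,
            derivable (fun s => x s i 0) t 1 &
            (fun s => x s i 0)^`()%classic t =
              delta G i * (- ((Rr G i)^-1 * omega t i 0) - x t i 0)
              - nu G i * (fun s => omega s i 0)^`()%classic t] &
      i \notin ID G -> qr t i 0 = q0 G i].

(* Here [omegas] is a vector: that the buses share one frequency is not part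
   of being a steady state. *)
Definition is_steady_state_solution (theta omega x qr : R -> 'cV[R]_n)
    (thetas omegas xs qs : 'cV[R]_n) : Prop :=
  is_solution theta omega x qr /\
  forall t : R,
  [/\ theta t = thetas + t *: omegas,
      omega t = omegas,
      forall i, i \in ID G -> x t i 0 = xs i 0 &
      qr t = qs].

Definition omega0 : R :=
  (\sum_i (pin G i + q0 G i)) /
  (\sum_i (D G i + (Rg G i)^-1) + \sum_(i in ID G) (Rr G i)^-1).

Definition has_iDroop_form (theta : R -> 'cV[R]_n)
    (thetas omegas xs qs : 'cV[R]_n) : Prop :=
  [/\ forall t : R, theta t = thetas + (omega0 * t) *: const_mx 1,
      forall i, omegas i 0 = omega0 &
      forall i, i \in ID G ->
        qs i 0 - q0 G i = xs i 0 /\ xs i 0 = - (omega0 / Rr G i)].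

Definition DeltaP : R := \sum_i (pin G i + q0 G i - D G i * omega0).

(* Summing the swing equations over the buses in steady state yields
   [\sum_i dqg i + \sum_(i in ID G) dqr i + DeltaP = 0], so the deviations of
   generators and inverters offset the imbalance [DeltaP]: hence the sign. *)
Definition balanced (dqg dqr : 'I_n -> R) : Prop :=
  \sum_i dqg i + \sum_(i in ID G) dqr i = - DeltaP.

Definition cost (ag ar dqg dqr : 'I_n -> R) : R :=
  \sum_i ag i / 2 * dqg i ^+ 2 + \sum_(i in ID G) ar i / 2 * dqr i ^+ 2.

Definition is_optimal (ag ar dqg dqr : 'I_n -> R) : Prop :=
  balanced dqg dqr /\
  forall dqg' dqr', balanced dqg' dqr' ->
    cost ag ar dqg dqr <= cost ag ar dqg' dqr'.

(* An allocation has inverter components only on [ID], so two allocations are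
   identified when their inverter parts agree there. *)
Definition is_unique_optimal (ag ar dqg dqr : 'I_n -> R) : Prop :=
  is_optimal ag ar dqg dqr /\
  forall dqg' dqr', is_optimal ag ar dqg' dqr' ->
    dqg' =1 dqg /\ {in ID G, dqr' =1 dqr}.

End Network.

(* Main.v *)
(* In steady state the right-hand side of the swing equation must be constant
   while [theta] drifts by [t *: omegas], so [omegas] lies in the kernel of the
   Laplacian; by connectedness (maximum principle) that kernel is spanned by
   the all-ones vector, and summing the swing equations over all buses gives
   the common frequency.  A steady state exists because [L + J], with [J] the
   all-ones matrix, is invertible, so [L] maps onto the vectors of zero sum.
   Optimality holds because all marginal costs equal [- omega0]: the excess
   cost of a balanced allocation is then a weighted sum of squares of its
   deviations from the iDroop allocation. *)
Require Import Defs.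
From HB Require Import structures.
From mathcomp Require Import all_boot all_order all_algebra.
From mathcomp Require Import all_classical all_reals all_analysis.
From mathcomp Require Import ring lra.
Import Order.TTheory GRing.Theory Num.Theory.
Import numFieldNormedType.Exports.

Local Open Scope ring_scope.

(** * Kernel and image of the weighted Laplacian of a connected graph *)

Section Laplacian.
Context {R : realType} {n : nat} (G : network R n).
Hypothesis hG : well_formed G.

Lemma laplacian_sym : (laplacian G)^T = laplacian G.
Proof.
have [[_ Gsym _ _] [bsym _ _ _]] := hG.
apply/matrixP => i j; rewrite !mxE eq_sym Gsym.
by case: eqP => [->//|_]; case: ifP => // /bsym ->.
Qed.

Lemma laplacian_mulE (v : 'cV[R]_n) i :
  (laplacian G *m v) i 0 = \sum_(k | edge G i k) b G i k * (v i 0 - v k 0).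
Proof.
have [[_ _ Girr _] _] := hG.
rewrite mxE (bigD1 i)//= !mxE eqxx mulr_suml.
under [RHS]eq_bigr do rewrite mulrBr.
rewrite sumrB; congr (_ + _).
rewrite -sumrN [RHS]big_mkcond [RHS](bigD1 i)//= Girr add0r.
apply: eq_bigr => k ki; rewrite mxE eq_sym (negPf ki).
by case: ifP => _; rewrite ?mul0r// mulNr.
Qed.

Lemma laplacian_ones : laplacian G *m const_mx 1 = 0 :> 'cV[R]_n.
Proof.
apply/colP => i; rewrite laplacian_mulE [RHS]mxE big1// => k _.
by rewrite !mxE subrr mulr0.
Qed.

(** By symmetry of the Laplacian, the all-ones vector lies in its left kernel as well. *)
Lemma sum_laplacian (v : 'cV[R]_n) : \sum_i (laplacian G *m v) i 0 = 0.
Proof.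
have : (const_mx 1 : 'rV[R]_n) *m laplacian G *m v = 0.
  by rewrite -laplacian_sym -[const_mx 1]trmx_const -trmx_mul laplacian_ones
             trmx0 mul0mx.
rewrite -mulmxA => /matrixP/(_ 0 0); rewrite [LHS]mxE [RHS]mxE.
apply: etrans; by apply: eq_bigr => i _; rewrite [const_mx _ _ _]mxE mul1r.
Qed.

(* Maximum principle: a neighbour of a maximizer of [v] is again one. *)
Lemma laplacian_ker (v : 'cV[R]_n) i j :
  laplacian G *m v = 0 -> v i 0 = v j 0.
Proof.
have [[_ Gsym _ Gconn] [_ bpos _ _]] := hG => Lv0.
have [m _ vm] : exists2 m : 'I_n, true & forall k, v k 0 <= v m 0.
  exists [arg max_(k > i) v k 0]%O => //.
  by case: arg_maxP => // m _ vm k; exact: vm.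
have stepP k l : edge G k l -> v k 0 == v m 0 -> v l 0 == v m 0.
  move=> kl /eqP vkm.
  (* At a maximizer [k] all summands of [(laplacian G *m v) k 0] are nonnegative and their sum is 0,
     so each vanishes; then [b G k l > 0] gives equality. *)
  have ge0 l' : edge G k l' -> 0 <= b G k l' * (v k 0 - v l' 0).
    by move=> kl'; rewrite mulr_ge0 ?subr_ge0 ?vkm ?vm// ltW ?bpos.
  have /eqP : \sum_(l | edge G k l) b G k l * (v k 0 - v l 0) = 0.
    by rewrite -laplacian_mulE Lv0 mxE.
  rewrite psumr_eq0// => /allP/(_ l (mem_index_enum _)) /implyP/(_ kl).
  by rewrite mulf_eq0 gt_eqF ?bpos//= subr_eq0 vkm eq_sym.
have maxP k : v k 0 = v m 0.
  (* Induction along a path from [m] to [k]: its starting point is generalized, the maximal value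
     [v m 0] stays fixed. *)
  apply/eqP; have /connectP[p] := Gconn m k.
  have : v m 0 == v m 0 by [].
  elim: p {1 3 4}m => [|l p IHp] h /= vh; first by move=> _ ->.
  by move=> /andP[hl]; apply: IHp; exact: stepP _ _ hl vh.
by rewrite !maxP.
Qed.

Lemma laplacian_surj (p : 'cV[R]_n) :
  \sum_i p i 0 = 0 -> exists v : 'cV[R]_n, laplacian G *m v = p.
Proof.
move=> p0; have n_neq0 : n%:R != 0 :> R.
  by have [[n_gt0 _ _ _] _] := hG; rewrite pnatr_eq0 -lt0n.
pose A := laplacian G + const_mx 1.
have JE (v : 'cV[R]_n) i : ((const_mx 1 : 'M[R]_n) *m v) i 0 = \sum_k v k 0.
  by rewrite mxE; apply: eq_bigr => k _; rewrite mxE mul1r.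
(* Summing the coordinates of [A *m v] kills the Laplacian part. *)
have AE (v : 'cV[R]_n) :
    \sum_i (A *m v) i 0 = 0 -> A *m v = laplacian G *m v /\ \sum_i v i 0 = 0.
  move=> sAv; suff v0 : \sum_i v i 0 = 0.
    by split=> //; apply/colP => i; rewrite mulmxDl mxE JE v0 addr0.
  move: sAv; under eq_bigr do rewrite mulmxDl mxE JE.
  rewrite big_split/= sum_laplacian add0r sumr_const card_ord -mulr_natr.
  by move/eqP; rewrite mulf_eq0 (negPf n_neq0) orbF => /eqP.
have A_unit : A \in unitmx.
  (* Transposing turns the row criterion into triviality of the kernel of [A] on columns. A kernel
     vector is constant by [laplacian_ker] and has zero sum, hence is 0. *)
  rewrite -unitmx_tr -row_free_unit; apply: inj_row_free => w.
  move=> /(congr1 trmx); rewrite trmx_mul trmxK trmx0 => Aw0.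
  have [|Lw0 sw0] := AE w^T; first by rewrite Aw0 big1// => i _; rewrite mxE.
  apply/rowP => i; rewrite mxE.
  have wE k : w^T k 0 = w^T i 0.
    by apply: laplacian_ker; rewrite -Lw0.
  move: sw0; under eq_bigr do rewrite wE.
  rewrite sumr_const card_ord -mulr_natr mxE => /eqP.
  by rewrite mulf_eq0 (negPf n_neq0) orbF => /eqP.
exists (invmx A *m p).
have [|<- _] := AE (invmx A *m p); by rewrite mulKVmx.
Qed.

End Laplacian.

(** * Steady states: existence, form and power balance *)

Section SteadyState.
Context {R : realType} {n : nat} (G : network R n).
Hypothesis hG : well_formed G.

Let gain : R :=
  \sum_i (D G i + (Rg G i)^-1) + \sum_(i in ID G) (Rr G i)^-1.

Lemma gain_gt0 : 0 < gain.
Proof.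
have [[n_gt0 _ _ _] [_ _ pos Rrpos]] := hG.
apply: ltr_wpDr.
  by apply: sumr_ge0 => i /Rrpos ?; rewrite invr_ge0 ltW.
rewrite (bigD1 (Ordinal n_gt0))//=; apply: ltr_pwDl.
  by have [_ D0 Rg0] := pos (Ordinal n_gt0); rewrite addr_gt0 ?invr_gt0.
by apply: sumr_ge0 => i _; have [_ D0 Rg0] := pos i; rewrite addr_ge0 ?invr_ge0 ?ltW.
Qed.

Lemma omega0_gain : omega0 G * gain = \sum_i (pin G i + q0 G i).
Proof. by rewrite /omega0 -/gain divfK// gt_eqF// gain_gt0. Qed.

(** The inverter output once iDroop has settled at common frequency [w]. *)
Definition steady_power (w : R) : 'cV[R]_n :=
  \col_i (q0 G i - (if i \in ID G then w / Rr G i else 0)).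

(** Used in both directions: for [w = omega0 G] the net power has zero sum, so it is in the image of
    the Laplacian; conversely, zero sum forces [w = omega0 G]. *)
Lemma sum_net_power (w : R) :
  \sum_i (pin G i + steady_power w i 0 - (D G i + (Rg G i)^-1) * w) =
  \sum_i (pin G i + q0 G i) - w * gain.
Proof.
rewrite /gain mulrDr !mulr_sumr [X in _ - (_ + X)]big_mkcond/=.
rewrite -big_split/= -sumrB; apply: eq_bigr => i _.
by rewrite mxE; case: ifP => _; ring.
Qed.

Lemma steady_state_exists :
  exists (theta omega x qr : R -> 'cV[R]_n) (thetas omegas xs qs : 'cV[R]_n),
    is_steady_state_solution G theta omega x qr thetas omegas xs qs /\
    has_iDroop_form G theta thetas omegas xs qs.
Proof.
pose w := omega0 G; pose qs := steady_power w.
pose p : 'cV[R]_n :=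
  \col_i (pin G i + qs i 0 - (D G i + (Rg G i)^-1) * w).
have [|thetas LthE] := laplacian_surj G hG p.
  under eq_bigr do rewrite mxE.
  by rewrite sum_net_power omega0_gain subrr.
pose omegas : 'cV[R]_n := const_mx w.
(* This value annihilates the droop bracket, so the controller equation holds for every [delta]. *)
pose xs : 'cV[R]_n := \col_i - (w / Rr G i).
have omegasE : omegas = w *: const_mx 1.
  by apply/colP => i; rewrite !mxE mulr1.
exists (fun t => thetas + t *: omegas), (fun=> omegas), (fun=> xs), (fun=> qs).
exists thetas, omegas, xs, qs; split; last first.
  split=> [t|i|i iID].
  - by rewrite omegasE scalerA mulrC.
  - by rewrite mxE.
  - by rewrite !mxE iID; split => //; ring.
split=> [t i|t]; last by split.
split.
- under [X in is_derive _ _ X _]eq_fun do rewrite !mxE.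
  rewrite mxE; apply: is_derive_eq.
  by rewrite /GRing.scale/=; ring.
- exact: derivable_cst.
- rewrite derive1_cst mulr0 mulmxDr -scalemxAr omegasE -scalemxAr.
  by rewrite laplacian_ones// !scaler0 addr0 LthE !mxE mulr1 subrr.
- move=> iID; split; first by rewrite !mxE iID.
  + exact: derivable_cst.
  + by rewrite !derive1_cst !mxE; ring.
- by move=> /negPf iID; rewrite mxE iID subr0.
Qed.

(** At a bus with [delta G i = 0] the steady controller equation reads 0 = 0 and leaves [xs i 0]
    free; a nonzero [delta] pins it to the droop value. *)
Lemma steady_state_form (theta omega x qr : R -> 'cV[R]_n)
    (thetas omegas xs qs : 'cV[R]_n) :
  is_steady_state_solution G theta omega x qr thetas omegas xs qs ->
  (forall i, i \in ID G -> delta G i != 0) ->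
  has_iDroop_form G theta thetas omegas xs qs.
Proof.
move=> [sol steady] delta0.
have thE t : theta t = thetas + t *: omegas by have [] := steady t.
have omE t : omega t = omegas by have [] := steady t.
have xE t i : i \in ID G -> x t i 0 = xs i 0.
  by have [_ _ + _] := steady t; exact.
have qE t : qr t = qs by have [] := steady t.
have dom0 t i : (fun s => omega s i 0)^`()%classic t = 0.
  by under eq_fun do rewrite omE; rewrite derive1_cst.
have swing t i : (laplacian G *m (thetas + t *: omegas)) i 0 =
    pin G i + qs i 0 - (D G i + (Rg G i)^-1) * omegas i 0.
  have [_ _ + _ _] := sol t i.
  by rewrite dom0 mulr0 qE omE thE => /esym/eqP; rewrite subr_eq0 => /eqP <-.
have Lom0 : laplacian G *m omegas = 0.
  (* The right-hand side of [swing] does not depend on time, so times 1 and 0 can be compared. *)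
  apply/colP => i; have := swing 1 i; rewrite -(swing 0 i).
  rewrite scale1r scale0r addr0 mulmxDr [LHS]mxE => /eqP.
  by rewrite -subr_eq0 addrAC subrr add0r [X in _ = X]mxE => /eqP.
have xsE i : i \in ID G -> xs i 0 = - (omegas i 0 / Rr G i).
  move=> iID; have [_ _ _ /(_ iID)[_ _ +] _] := sol 0 i.
  have -> : (fun s => x s i 0) = cst (xs i 0).
    by apply/funext => s; rewrite xE.
  rewrite derive1_cst dom0 mulr0 subr0 omE xE// => /esym/eqP.
  rewrite mulf_eq0 (negPf (delta0 _ iID))/= subr_eq0 => /eqP <-.
  by rewrite mulrC.
have qsE i : qs i 0 = q0 G i + (if i \in ID G then xs i 0 else 0).
  have [_ _ _ hin hout] := sol 0 i; rewrite -(qE 0).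
  case: ifPn => iID; last by rewrite hout// addr0.
  by have [-> _ _] := hin iID; rewrite xE.
have [[n_gt0 _ _ _] _] := hG.
pose w := omegas (Ordinal n_gt0) 0.
have omw i : omegas i 0 = w by exact: laplacian_ker hG _ _ _ Lom0.
have w0 : w = omega0 G.
  apply: (mulIf (lt0r_neq0 gain_gt0)); rewrite omega0_gain.
  apply/esym/eqP; rewrite -subr_eq0 -sum_net_power; apply/eqP.
  (* The zero is written as a Laplacian sum at time 0, so that [swing] applies bus by bus. *)
  rewrite -[RHS](sum_laplacian G hG (thetas + 0 *: omegas)).
  apply: eq_bigr => i _; rewrite swing qsE omw mxE; congr (_ + _ - _).
  by case: ifP => iID; rewrite ?oppr0// xsE// omw.
split=> [t|i|i iID].
- rewrite thE; congr (_ + _); apply/colP => i.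
  by rewrite !mxE omw w0 mulr1 mulrC.
- by rewrite omw.
- by rewrite qsE iID xsE// omw w0 addrC addKr.
Qed.

(** The total response is [- omega0 G] times [gain] without its damping part, and [omega0 G * gain]
    is the total injection. *)
Lemma balanced_droop (dqg dqr : 'I_n -> R) :
  (forall i, dqg i = - ((Rg G i)^-1 * omega0 G)) ->
  {in ID G, forall i, dqr i = - (omega0 G / Rr G i)} ->
  balanced G dqg dqr.
Proof.
move=> dqgE dqrE; rewrite /balanced /DeltaP sumrB -omega0_gain /gain.
rewrite (eq_bigr _ (fun i _ => dqgE i)) (eq_bigr _ dqrE).
rewrite !sumrN -mulr_suml -mulr_sumr -mulr_suml big_split/=.
ring.
Qed.

End SteadyState.

(** * Optimality of allocations with equal marginal costs *)

Section Optimality.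
Context {R : realType} {n : nat} (G : network R n).
Variables (ag ar dqg dqr : 'I_n -> R) (l : R).
Hypotheses (dqg_marginal : forall i, ag i * dqg i = l)
  (dqr_marginal : {in ID G, forall i, ar i * dqr i = l}).

(* The linear term of the expansion is [l] times the difference of the
   total allocations, hence vanishes. *)
Lemma cost_excess (dqg' dqr' : 'I_n -> R) :
  balanced G dqg dqr -> balanced G dqg' dqr' ->
  cost G ag ar dqg' dqr' = cost G ag ar dqg dqr +
    cost G ag ar (fun i => dqg' i - dqg i) (fun i => dqr' i - dqr i).
Proof.
move=> bal bal'.
(* Exact second-order Taylor expansion at [u]; the common slope [l] is the Lagrange multiplier of
   the balance constraint. *)
have expand (a u u' : R) : a * u = l ->
    a / 2 * u' ^+ 2 = a / 2 * u ^+ 2 + a / 2 * (u' - u) ^+ 2 + l * (u' - u).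
  by move=> <-; field.
rewrite /cost (eq_bigr _ (fun i _ => expand _ _ (dqg' i) (dqg_marginal i))).
rewrite (eq_bigr _ (fun i iID => expand _ _ (dqr' i) (dqr_marginal i iID))).
rewrite !big_split/= -!mulr_sumr !sumrB.
move: bal bal'; rewrite /balanced => bal bal'.
have : l * (\sum_i dqg' i - \sum_i dqg i) +
       l * (\sum_(i in ID G) dqr' i - \sum_(i in ID G) dqr i) = 0.
  by rewrite -mulrDr addrACA bal' -opprD bal subrr mulr0.
move=> lin0; lra.
Qed.

Hypotheses (ag_gt0 : forall i, 0 < ag i)
  (ar_gt0 : forall i, i \in ID G -> 0 < ar i).

(** The excess in [cost_excess] is a positive definite quadratic form in the deviations:
    nonnegativity gives optimality, definiteness gives uniqueness. *)
Lemma equal_marginal_unique_optimal :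
  balanced G dqg dqr -> is_unique_optimal G ag ar dqg dqr.
Proof.
move=> bal.
have g_ge0 (u : 'I_n -> R) i : true -> 0 <= ag i / 2 * u i ^+ 2.
  by rewrite mulr_ge0 ?sqr_ge0// divr_ge0// ltW.
have r_ge0 (u : 'I_n -> R) i : i \in ID G -> 0 <= ar i / 2 * u i ^+ 2.
  by move=> /ar_gt0 ?; rewrite mulr_ge0 ?sqr_ge0// divr_ge0// ltW.
have cost_ge0 u v : 0 <= cost G ag ar u v.
  by apply: addr_ge0; apply: sumr_ge0 => i; [exact: g_ge0|exact: r_ge0].
have sq0 (a u : R) : 0 < a -> a / 2 * u ^+ 2 == 0 -> u = 0.
  move=> a0; rewrite mulf_eq0 gt_eqF ?divr_gt0//= sqrf_eq0.
  by move/eqP.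
have cost_eq0 u v : cost G ag ar u v == 0 ->
    (forall i, u i = 0) /\ {in ID G, forall i, v i = 0}.
  rewrite /cost paddr_eq0; first last.
  - by apply: sumr_ge0 => i; exact: r_ge0.
  - by apply: sumr_ge0 => i; exact: g_ge0.
  rewrite !psumr_eq0; [|exact: r_ge0|exact: g_ge0].
  move=> /andP[/allP gs /allP rs]; split=> [i|i iID].
  - exact: sq0 _ _ (ag_gt0 i) (gs i (mem_index_enum _)).
  - exact: sq0 _ _ (ar_gt0 i iID) (implyP (rs i (mem_index_enum _)) iID).
split.
  split=> // dqg' dqr' bal'; rewrite (cost_excess _ _ bal bal') lerDl.
  exact: cost_ge0.
move=> dqg' dqr' [bal' /(_ _ _ bal)].
(* A competing optimum has excess at most 0, hence exactly 0. *)
rewrite (cost_excess _ _ bal bal') gerDl => le0.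
have [|dqg0 dqr0] := cost_eq0 (fun i => dqg' i - dqg i) (fun i => dqr' i - dqr i).
  by rewrite eq_le le0 cost_ge0.
by split=> [i|i iID]; apply/eqP; rewrite -subr_eq0; apply/eqP;
  [exact: dqg0|exact: dqr0].
Qed.

End Optimality.

Theorem theorem3 (R : realType) (n : nat) (G : network R n)
    (ag ar : 'I_n -> R)
    (hG : well_formed G)
    (hag : forall i, 0 < ag i)
    (har : forall i, i \in ID G -> 0 < ar i) :
  (exists (theta omega x qr : R -> 'cV[R]_n) (thetas omegas xs qs : 'cV[R]_n),
     is_steady_state_solution G theta omega x qr thetas omegas xs qs /\
     has_iDroop_form G theta thetas omegas xs qs) /\
  (forall (theta omega x qr : R -> 'cV[R]_n) (thetas omegas xs qs : 'cV[R]_n),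
     is_steady_state_solution G theta omega x qr thetas omegas xs qs ->
     (forall i, i \in ID G -> delta G i != 0) ->
     has_iDroop_form G theta thetas omegas xs qs) /\
  (forall (theta omega x qr : R -> 'cV[R]_n) (thetas omegas xs qs : 'cV[R]_n),
     is_steady_state_solution G theta omega x qr thetas omegas xs qs ->
     has_iDroop_form G theta thetas omegas xs qs ->
     (forall i, Rg G i = ag i) ->
     (forall i, i \in ID G -> Rr G i = ar i) ->
     is_unique_optimal G ag ar
       (fun i => - ((Rg G i)^-1 * omega0 G))
       (fun i => qs i 0 - q0 G i)).
Proof.
split; first exact: steady_state_exists.
split=> [|theta omega x qr thetas omegas xs qs _ [_ _ form] RgE RrE].
  by move=> *; apply: steady_state_form; eassumption.
have dqrE : {in ID G, forall i, qs i 0 - q0 G i = - (omega0 G / Rr G i)}.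
  by move=> i /form[-> ->].
apply: (@equal_marginal_unique_optimal _ _ _ _ _ _ _ (- omega0 G)) => //.
- by move=> i; rewrite RgE mulrN mulVKf// gt_eqF.
- move=> i iID; rewrite dqrE// RrE// mulrN mulrCA divff ?mulr1//.
  by rewrite gt_eqF ?har.
- exact: balanced_droop.
Qed.
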